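(* Let $J$ be a finitely generated ideal of a nilpotent-free semiring $S$. Then $J$ is contained in a minimal prime ideal $P$ of $S$ if and only if $\operatorname{Ann}(J) \neq (0)$.
   Context: A semiring is a set $S$ with operations $+,\cdot$ such that $(S,+)$ is a commutative monoid with identity $0$, $(S,\cdot)$ is a commutative monoid with identity $1\neq 0$, multiplication distributes over addition, and $s\cdot 0=0$ for all $s\in S$. A semiring is nilpotent-free if $s^n=0$ for some positive integer $n$ implies $s=0$. A nonempty subset $I\subseteq S$ is an ideal if $a+b\in I$ and $sa\in I$ for all $a,b\in I$, $s\in S$. An ideal $P\neq S$ is prime if $ab\in P$ implies $a\in P$ or $b\in P$. A minimal prime ideal of $S$ is a prime ideal that is minimal with respect to inclusion among all prime ideals of $S$. For a nonempty $H\subseteq S$, $\operatorname{Ann}(H)=\{s\in S: sh=0 \text{ for all } h\in H\}$. *)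

(* Defs.v *)
From HB Require Import structures.
From mathcomp Require Import all_boot all_algebra.
From mathcomp Require Import boolp classical_sets functions cardinality.

Set Implicit Arguments.
Unset Strict Implicit.
Unset Printing Implicit Defensive.

Import GRing.Theory.

Local Open Scope classical_set_scope.
Local Open Scope ring_scope.

(* Semirings are commutative with 1 != 0, hence [comNzSemiRingType].
   MathComp's own ideals ([idealr_closed], [idealr]) are decidable, proper and
   only available over rings; the notions below are for arbitrary subsets of a
   semiring, and an ideal need not be proper. *)

Definition nilpotent_free (S : comNzSemiRingType) : Prop :=
  forall (s : S) (n : nat), (0 < n)%N -> s ^+ n = 0 -> s = 0.

Definition is_ideal (S : comNzSemiRingType) (I : set S) : Prop :=
  [/\ I !=set0,
      (forall a b, I a -> I b -> I (a + b)) &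
      (forall s a, I a -> I (s * a))].

Definition prime_ideal (S : comNzSemiRingType) (P : set S) : Prop :=
  [/\ is_ideal P, P <> setT & forall a b, P (a * b) -> P a \/ P b].

Definition minimal_prime_ideal (S : comNzSemiRingType) (P : set S) : Prop :=
  prime_ideal P /\ forall Q : set S, prime_ideal Q -> Q `<=` P -> Q = P.

(* [smallest is_ideal A] is the ideal generated by [A]. *)
Definition finitely_generated_ideal (S : comNzSemiRingType) (J : set S) : Prop :=
  exists2 A : set S, finite_set A & J = smallest (@is_ideal S) A.

Definition Ann (S : comNzSemiRingType) (H : set S) : set S :=
  [set s | forall h, H h -> s * h = 0].

(* Main.v *)
Require Import Defs.
From HB Require Import structures.
From mathcomp Require Import all_boot all_algebra.
From mathcomp Require Import boolp classical_sets functions cardinality.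

Import GRing.Theory.

Local Open Scope classical_set_scope.
Local Open Scope ring_scope.

(* In a nilpotent-free semiring the complement of a maximal zero-free
   multiplicative set [M] is [{x | y * x = 0 for some y in M}], which is visibly
   an ideal and a minimal prime. With Zorn's lemma, every zero-free
   multiplicative set is therefore disjoint from some minimal prime. Applied to
   the powers of a nonzero [s] in [Ann J], this gives a minimal prime avoiding
   [s], hence containing [J]. Applied to the set generated by [x] and the
   complement of a minimal prime [P] containing [x], it shows that [x] is killed
   by an element outside [P]; a product of such elements, one for each generator
   of [J], is a nonzero element of [Ann J]. *)

Section Semiring.
Set Implicit Arguments.
Unset Strict Implicit.
Variable S : comNzSemiRingType.
Implicit Types (M P T : set S) (x y s : S).

Definition zero_free_mult M : Prop :=
  [/\ M 1, (forall a b, M a -> M b -> M (a * b)) & ~ M 0].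

Definition mult_adjoin M x : set S :=
  [set z | exists y n, M y /\ z = y * x ^+ n].

Lemma sub_mult_adjoin M x : M `<=` mult_adjoin M x.
Proof. by move=> y My; exists y, 0%N; rewrite expr0 mulr1. Qed.

Lemma mem_mult_adjoin M x : M 1 -> mult_adjoin M x x.
Proof. by move=> M1; exists 1, 1%N; rewrite mul1r expr1. Qed.

Lemma mult_adjoinM M x : (forall a b, M a -> M b -> M (a * b)) ->
  forall a b, mult_adjoin M x a -> mult_adjoin M x b ->
              mult_adjoin M x (a * b).
Proof.
move=> MM _ _ [a [m [Ma ->]]] [b [n [Mb ->]]].
by exists (a * b), (m + n)%N; split; [exact: MM | rewrite exprD mulrACA].
Qed.

Lemma ideal0 P : is_ideal P -> P 0.
Proof. by case=> -[a Pa] _ /(_ 0 a Pa); rewrite mul0r. Qed.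

Lemma prime_ideal_not1 P : prime_ideal P -> ~ P 1.
Proof.
case=> -[_ _ PM] PT _ P1; apply: PT; apply/seteqP; split=> // x _.
by rewrite -[x]mulr1; exact: PM.
Qed.

Lemma is_ideal_Ann1 y : is_ideal (Ann [set y]).
Proof.
split.
- by exists 0 => h _; rewrite mul0r.
- by move=> a b aP bP h hy; rewrite mulrDl aP // bP // addr0.
- by move=> s a aP h hy; rewrite -mulrA aP // mulr0.
Qed.

Hypothesis S_nilfree : nilpotent_free S.

(** From [y * x ^+ n = 0] follows [(y * x) ^+ n.+1 = 0], and nilpotent-freeness removes the
    exponent, which is positive even for [n = 0]. *)
Lemma mult_adjoin0 M x : mult_adjoin M x 0 -> exists2 y, M y & y * x = 0.
Proof.
move=> [y [n [My yxn0]]]; exists y => //; apply: (S_nilfree (n := n.+1)) => //.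
by rewrite exprMn exprSr [x ^+ _]exprSr mulrA -(mulrA (y ^+ n)) -yxn0 mulr0 mul0r.
Qed.

Lemma maximal_zero_free_mult T : zero_free_mult T ->
  exists M, [/\ zero_free_mult M, T `<=` M &
    forall x, ~ M x -> exists2 y, M y & y * x = 0].
Proof.
move=> zT; have [T1 TM T0] := zT.
(* Adjoining [T] to the members keeps the empty chain harmless. *)
have [F FP totF|A [zA maxA]] :=
  @Zorn_bigcup S [set X | zero_free_mult (T `|` X)].
  split; first by left.
  (* Totality of [F] puts two elements in one common member. If both lie in [T], there may be no
     member to choose, hence the separate alternative. *)
  - have chain a b : (T `|` \bigcup_(X in F) X) a ->
        (T `|` \bigcup_(X in F) X) b ->
        (T a /\ T b) \/ exists X, [/\ F X, (T `|` X) a & (T `|` X) b].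
      move=> [Ta|[X FX Xa]] [Tb|[Y FY Yb]]; first by left.
      + by right; exists Y; split=> //; [left|right].
      + by right; exists X; split=> //; [right|left].
      + right; have [XY|YX] := totF _ _ FX FY.
          by exists Y; split=> //; right=> //; exact: XY.
        by exists X; split=> //; right=> //; exact: YX.
    move=> a b Ua Ub; have [[Ta Tb]|[X [FX Xa Xb]]] := chain _ _ Ua Ub.
      by left; exact: TM.
    have [_ XM _] := FP _ FX.
    by have [?|?] := XM _ _ Xa Xb; [left|right; exists X].
  - by move=> [//|[X FX X0]]; have [_ _] := FP _ FX; apply; right.
exists (T `|` A); split; [exact: zA | exact: subsetUl |].
move=> x nMx; apply: mult_adjoin0; apply: contrapT => n0.
have [M1 MM _] := zA.
(* By [n0], adjoining [x] creates no zero, so it yields a strictly larger admissible set, against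
   maximality of [A]. *)
apply: (maxA (mult_adjoin (T `|` A) x)).
  rewrite properEneq; split; last by move=> a Aa; apply: sub_mult_adjoin; right.
  apply/eqP => EA; apply: nMx; right; rewrite EA; exact: mem_mult_adjoin.
rewrite /= (_ : T `|` _ = mult_adjoin (T `|` A) x).
  by split=> //; [exact: sub_mult_adjoin | exact: mult_adjoinM].
by apply/setUidPr => a Ta; apply: sub_mult_adjoin; left.
Qed.

Lemma minimal_prime_avoiding T : zero_free_mult T ->
  exists2 P, minimal_prime_ideal P & forall x, P x -> ~ T x.
Proof.
move=> /maximal_zero_free_mult[M [[M1 MM M0] TM maxM]].
have killed x y : M y -> y * x = 0 -> ~ M x.
  by move=> My yx0 Mx; apply: M0; rewrite -yx0; exact: MM.
exists (~` M); last by move=> x nMx /TM.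
split; first split.
- split; first by exists 0.
  + move=> a b /maxM[y My ya0] /maxM[z Mz zb0]; apply: (killed _ (y * z)).
      exact: MM.
    by rewrite mulrDr mulrAC ya0 mul0r -mulrA zb0 mulr0 addr0.
  + move=> s a /maxM[y My ya0]; apply: (killed _ y) => //.
    by rewrite mulrCA ya0 mulr0.
- by move=> MT; have : (~` M) 1 by rewrite MT.
- move=> a b nMab; apply: contrapT => /not_orP[/contrapT Ma /contrapT Mb].
  by apply: nMab; exact: MM.
(* Minimality: [y * x = 0] lies in [Q] and [y] does not, so primality forces [x] into [Q]. *)
- move=> Q [Qid _ QP] QM; apply/seteqP; split=> // x /maxM[y My yx0].
  have : Q (y * x) by rewrite yx0; exact: ideal0.
  by case/QP => // /QM.
Qed.

Lemma minimal_prime_killed P x : minimal_prime_ideal P -> P x ->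
  exists2 y, ~ P y & y * x = 0.
Proof.
move=> [Pprime Pmin] Px; have [_ _ PP] := Pprime.
apply: (@mult_adjoin0 (~` P)); apply: contrapT => n0.
have P1 := prime_ideal_not1 Pprime.
(* A prime [Q] avoiding this set lies inside [P] and misses [x]; minimality gives [Q = P], which
   contains [x]. *)
have [|Q [Qprime _] QT] := @minimal_prime_avoiding (mult_adjoin (~` P) x).
  split=> //; first exact: sub_mult_adjoin.
  by apply: mult_adjoinM => a b nPa nPb /PP[].
have QP : Q `<=` P.
  move=> z Qz; apply: contrapT => nPz.
  by apply: (QT z) => //; exact: sub_mult_adjoin.
apply: (QT x); last exact: mem_mult_adjoin.
by rewrite (Pmin _ Qprime QP).
Qed.

(** Killers of the single entries are multiplied, starting from 1; primality keeps the product
    outside [P]. *)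
Lemma minimal_prime_killed_seq P (l : seq S) : minimal_prime_ideal P ->
  {in l, forall x, P x} -> exists2 y, ~ P y & {in l, forall x, y * x = 0}.
Proof.
move=> Pmin; have [Pprime _] := Pmin; have [_ _ PP] := Pprime.
elim: l => [_|a l IH lP]; first by exists 1 => //; exact: prime_ideal_not1.
have [|y nPy yl0] := IH; first by move=> x xl; apply: lP; rewrite inE xl orbT.
have [|z nPz za0] := @minimal_prime_killed P a Pmin.
  by apply: lP; rewrite inE eqxx.
exists (y * z) => [/PP[]//|x]; rewrite inE => /predU1P[->|xl].
  by rewrite -mulrA za0 mulr0.
by rewrite mulrAC yl0 // mul0r.
Qed.

End Semiring.

Theorem corollary3p7 (S : comNzSemiRingType) (hS : nilpotent_free S)
    (J : set S) (hJ : is_ideal J) (hJfg : finitely_generated_ideal J) :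
  (exists P : set S, minimal_prime_ideal P /\ J `<=` P) <-> Ann J <> [set 0].
Proof.
split=> [[P [Pmin JP]] AnnJ0|AnnJ].
  have [A /finite_seqP[l Al] JA] := hJfg.
  have [|y nPy yl0] := @minimal_prime_killed_seq S hS P l Pmin.
    move=> x xl; apply: JP; rewrite JA; apply: sub_gen_smallest.
    by rewrite Al.
  have Py : P 0 by apply: ideal0; case: Pmin => -[].
  suff y0 : y = 0 by apply: nPy; rewrite y0.
  suff : Ann J y by rewrite AnnJ0.
  (* Killing the generators suffices: [Ann [set y]] is an ideal containing [A], hence contains
     [J]. *)
  move=> h; rewrite JA => /(_ (Ann [set y])) hA.
  rewrite mulrC; apply: hA => //; split; first exact: is_ideal_Ann1.
  by move=> a; rewrite Al => la _ ->; rewrite mulrC yl0.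
have [s [sJ0 s0]] : exists s, Ann J s /\ s <> 0.
  apply: contrapT => nex; apply: AnnJ; apply/seteqP; split=> [s sJ|_ ->].
    by apply: contrapT => s0; apply: nex; exists s.
  by move=> h _; rewrite mul0r.
have [|P Pmin Ps] := @minimal_prime_avoiding S hS (range (fun n => s ^+ n)).
  split; first by exists 0%N.
    by move=> _ _ [m _ <-] [n _ <-]; exists (m + n)%N; rewrite ?exprD.
  (* Nilpotent-freeness covers positive exponents only; exponent 0 uses [1 != 0]. *)
  move=> [[|n] _]; first by rewrite expr0 => /eqP; rewrite oner_eq0.
  by move=> /hS sn0; apply: s0; exact: sn0.
exists P; split=> // x Jx; have [[Pid _ PP] _] := Pmin.
have : P (s * x) by rewrite sJ0 //; exact: ideal0.
by case/PP => // /Ps[]; exists 1%N.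
Qed.
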